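(* Let $K\ge 1$ be an integer, let $r_0\sim\mathcal{U}(0,1)$ and let $\mathbf{c}_0=(c_0^1,\dots,c_0^K)$ be i.i.d. random variables with distribution $\mathcal{U}(0,1)$, independent of $r_0$. Let $c_0^{(1)}\le\dots\le c_0^{(K)}$ be the order statistics of $\mathbf{c}_0$, set $c_0^{(0)}:=0$ and $c_0^{(K+1)}:=1$, and define $$\ell_1=c_0^{(j+1)}-c_0^{(j)}\qquad\text{if } c_0^{(j)}\le r_0<c_0^{(j+1)}\quad(j=0,\dots,K).$$ Then $$\mathbb{E}[\ell_1]=\frac{2}{K+2}.$$
   Context: $\mathcal{U}(0,1)$ is the uniform distribution on $(0,1)$. The variable $\ell_1$ is the length of the subinterval of $[0,1]$ containing the root $r_0$ after cutting $[0,1]$ at $K$ independent uniform points. *)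

(* Defs.v *)
From HB Require Import structures.
From mathcomp Require Import all_boot all_order all_algebra.
From mathcomp Require Import all_classical all_reals all_analysis.

Set Implicit Arguments.
Unset Strict Implicit.
Unset Printing Implicit Defensive.

Import Order.TTheory GRing.Theory Num.Theory.
Import numFieldNormedType.Exports.

Local Open Scope classical_set_scope.
Local Open Scope ring_scope.

Section random_variables.
Context d (T : measurableType d) (R : realType) (P : probability T R).

(* The two laws are compared on Borel sets only, because the value of
   [uniform_prob] on a non-measurable set carries no meaning. *)
Definition uniform01 (X : {RV P >-> R}) : Prop :=
  forall A : set R, measurable A ->
    distribution P X A = uniform_prob (@ltr01 R) A.

Definition independent_RVs d1 d2
    (T1 : measurableType d1) (T2 : measurableType d2)
    (X : {RV P >-> T1}) (Y : {RV P >-> T2}) : Prop :=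
  forall (A : set T1) (B : set T2), measurable A -> measurable B ->
    P (X @^-1` A `&` Y @^-1` B) = (P (X @^-1` A) * P (Y @^-1` B))%E.

Definition mutually_independent_RVs d' (T' : measurableType d') (I : finType)
    (X : I -> {RV P >-> T'}) : Prop :=
  forall (J : {set I}) (A : I -> set T'), (forall i, measurable (A i)) ->
    P (\bigcap_(i in [set` J]) (X i @^-1` A i)) =
    (\prod_(i in J) P (X i @^-1` A i))%E.

Definition iid_uniform01 (I : finType) (X : I -> {RV P >-> R}) : Prop :=
  mutually_independent_RVs X /\ forall i, uniform01 (X i).

Definition random_vector d' (T' : measurableType d') (n : nat)
    (X : 'I_n -> {RV P >-> T'}) (t : T) : n.-tuple T' := [tuple X i t | i < n].

Lemma measurable_random_vector d' (T' : measurableType d') (n : nat)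
    (X : 'I_n -> {RV P >-> T'}) : measurable_fun [set: T] (random_vector X).
Proof.
apply/measurable_fun_tnthP => i.
rewrite (_ : _ \o _ = X i); first exact: measurable_funPT.
by apply/funext => t; rewrite /= tnth_mktuple.
Qed.

HB.instance Definition _ d' (T' : measurableType d') (n : nat)
    (X : 'I_n -> {RV P >-> T'}) :=
  isMeasurableFun.Build _ _ T (n.-tuple T') (random_vector X)
    (measurable_random_vector X).

End random_variables.

Section cutting.
Context (R : realType) (K : nat).
Implicit Types (c : K.-tuple R) (r : R) (j : nat).

(* [cut_point c j] is c^(j) for 0 <= j <= K + 1: index 0 is the endpoint 0,
   indices 1, ..., K are the order statistics, index K + 1 is the endpoint 1. *)
Definition cut_point c j : R := (0 :: rcons (sort <=%R c) 1)`_j.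

(* At most one j qualifies ([piece_unique]). The value 0 is a convention for
   the case where none does, which requires r outside [0, 1[
   ([piece_exists]), an event of probability 0 when r is uniform. *)
Definition piece_length c r : R :=
  if [pick j : 'I_K.+1 | cut_point c j <= r < cut_point c j.+1] is Some j
  then cut_point c j.+1 - cut_point c j else 0.

End cutting.

Section cutting_lemmas.
Context (R : realType) (K : nat).
Implicit Types (c : K.-tuple R) (r : R) (j : nat).

Lemma cut_point0 c : cut_point c 0 = 0.
Proof. by []. Qed.

Lemma cut_point_last c : cut_point c K.+1 = 1.
Proof. by rewrite /cut_point /= nth_rcons size_sort size_tuple ltnn eqxx. Qed.

Lemma cut_point_le c i j : (0 < i)%N -> (i <= j <= K)%N ->
  cut_point c i <= cut_point c j.
Proof.
case: i => // i _; case: j => [|j]; first by rewrite ltn0.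
move=> /andP[ij jK]; rewrite /cut_point /= !nth_rcons size_sort size_tuple.
have iK : (i < K)%N by exact: leq_ltn_trans jK.
rewrite jK iK.
apply: (sorted_leq_nth le_trans lexx) => //; rewrite ?inE ?size_sort ?size_tuple //.
exact: (sort_sorted (@le_total _ R)).
Qed.

Lemma piece_unique c r i j : (i <= K)%N -> (j <= K)%N ->
  cut_point c i <= r < cut_point c i.+1 ->
  cut_point c j <= r < cut_point c j.+1 -> i = j.
Proof.
wlog ij : i j / (i < j)%N => [hw iK jK hi hj|iK jK /andP[_ ri] /andP[jr _]].
  by have [ij|ij|//] := ltngtP i j; [exact: hw|symmetry; exact: hw].
have : cut_point c i.+1 <= cut_point c j by rewrite cut_point_le// ij.
by move=> /(lt_le_trans ri) /lt_le_trans /(_ jr); rewrite ltxx.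
Qed.

Lemma piece_lengthE c r j : (j <= K)%N ->
  cut_point c j <= r < cut_point c j.+1 ->
  piece_length c r = cut_point c j.+1 - cut_point c j.
Proof.
move=> jK hj; rewrite /piece_length.
case: pickP => [i hi|/(_ (Ordinal (jK : (j < K.+1)%N)))].
  by rewrite (@piece_unique c r i j)// -ltnS.
by rewrite hj.
Qed.

Lemma piece_exists c r : 0 <= r < 1 ->
  exists2 j, (j <= K)%N & cut_point c j <= r < cut_point c j.+1.
Proof.
move=> /andP[r0 r1].
have ex : exists n, r < cut_point c n by exists K.+1; rewrite cut_point_last.
have nK := ex_minnP ex; case: nK => -[|n] rn nmin.
  by move: rn; rewrite cut_point0 ltNge r0.
exists n; first by rewrite -ltnS; apply: nmin; rewrite cut_point_last.
rewrite rn andbT leNgt; apply/negP => /nmin; rewrite ltnn.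
by [].
Qed.

End cutting_lemmas.

(* Main.v *)
Require Import Defs.
From HB Require Import structures.
From mathcomp Require Import all_boot all_order all_algebra.
From mathcomp Require Import all_classical all_reals all_analysis.
From mathcomp Require Import measurable_realfun ring lra.

Import Order.TTheory GRing.Theory Num.Theory.
Import numFieldNormedType.Exports.

Local Open Scope classical_set_scope.
Local Open Scope ring_scope.

(** The piece that contains a uniform point [r0] is size-biased, and its length
    is the probability that an auxiliary uniform point [x], independent of
    everything else, falls in the same piece. So the expected length is the
    probability that none of the [K] cuts separates [x] from [r0].

    Separation is easy to read on the unsorted cuts: a cut [c] leaves [x] and
    [r] on the same side exactly when [c <= x] and [c <= r] have the same truth
    value ([same_piece], [piece_length_uniform]). For fixed [x] and [r] in
    [0, 1] one uniform cut does so with probability [1 - `|x - r|]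
    ([uniform01_same_side]), hence [K] independent cuts with probability
    [(1 - `|x - r|) ^+ K] ([prob_same_piece]). Tonelli's theorem introduces
    [x] ([integral_measure_sections]), the independence of [r0] and the cuts
    allows conditioning on [r0] ([independent_RVs_sections]), and what remains
    is the double integral of [(1 - `|x - r|) ^+ K] over the unit square,
    which is [2 / (K + 2)] ([integral_integral_onem_dist_X]).

    The order statistics matter only for identifying the piece of [r0] with the
    set of points not separated from it, and for the measurability of the
    length. *)

Set Implicit Arguments.
Unset Strict Implicit.

(** * A double integral over the unit square *)

Section calculus.
Context (R : realType).
Notation mu := (@lebesgue_measure R).

(** Working with formal derivatives reduces the integrals below to algebra. *)
Lemma integral_deriv_poly (p : {poly R}) (a b : R) : a <= b ->
  (\int[mu]_(x in `[a, b]) (p^`().[x])%:E = (p.[b] - p.[a])%:E)%E.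
Proof.
rewrite le_eqVlt => /predU1P[->|ab].
  by rewrite set_itv1 integral_set1 subrr.
rewrite (continuous_FTC2 ab (F := horner p)).
- by rewrite EFinB.
- exact/continuous_subspaceT/continuous_horner.
- split=> [x _||]; first exact: derivable_horner.
  + exact/cvg_at_right_filter/continuous_horner.
  + exact/cvg_at_left_filter/continuous_horner.
- by move=> x _; rewrite -derivE.
Qed.

(** Scaling by [n.+1%:R] rather than iterating addition keeps the factor in a
    form that [field] cancels after evaluation. *)
Lemma deriv_expS (p : {poly R}) n :
  (p ^+ n.+1)^`() = n.+1%:R *: (p^`() * p ^+ n).
Proof. by rewrite deriv_exp scaler_nat. Qed.

Let derivsE :=
  (derivZ, derivD, derivN, deriv_expS, derivX, derivC, add0r, sub0r, mul1r,
   mulN1r, alg_polyC).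
Let hornersE :=
  (hornerZ, hornerD, hornerN, hornerX, hornerC, horner_exp).

(** The absolute value is removed by cutting at [x]; [q1] and [q2] are
    primitives of the integrand on either side. *)
Lemma integral_onem_dist_X K (x : R) : 0 <= x <= 1 ->
  (\int[mu]_(r in `[0%R, 1%R]) ((1 - `|x - r|) ^+ K)%:E =
   ((2 - (1 - x) ^+ K.+1 - x ^+ K.+1) / K.+1%:R)%:E)%E.
Proof.
move=> /andP[x0 x1].
have K0 : K.+1%:R != 0 :> R by rewrite pnatr_eq0.
pose q1 : {poly R} := K.+1%:R^-1 *: ((1 - x)%:P + 'X) ^+ K.+1.
pose q2 : {poly R} := - (K.+1%:R^-1 *: ((1 + x)%:P - 'X) ^+ K.+1).
have q1E r : q1^`().[r] = (1 - x + r) ^+ K.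
  rewrite /q1 !derivsE !hornersE.
  by field; rewrite addrC natr1.
have q2E r : q2^`().[r] = (1 + x - r) ^+ K.
  rewrite /q2 !derivsE !hornersE.
  by field; rewrite addrC natr1.
have mf : measurable_fun [set: R] ((fun r => (1 - `|x - r|) ^+ K) : R -> R).
  apply/measurable_funX/measurable_funB => //.
  by apply: measurableT_comp => //; exact: measurable_funB.
rewrite (@itv_bndbnd_setU _ _ _ (BLeft x)) ?bnd_simp//.
rewrite ge0_integral_setU//=; last 3 first.
- exact/measurable_EFinP/measurable_funTS.
- move=> r r01; rewrite lee_fin exprn_ge0// subr_ge0 ler_norml.
  by case: r01 => /=; rewrite in_itv/=; lra.
- apply/disj_setPS => r [] /=; rewrite !in_itv/=; lra.
rewrite integral_itv_bndo_bndc; last exact/measurable_EFinP/measurable_funTS.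
rewrite (_ : (2 - _ - _) / _ =
  (q1.[x] - q1.[0]) + (q2.[1] - q2.[x])); last first.
  rewrite /q1 /q2 !hornersE addr0.
  rewrite (_ : 1 - x + x = 1); last by ring.
  rewrite (_ : 1 + x - 1 = x); last by ring.
  rewrite (_ : 1 + x - x = 1); last by ring.
  by rewrite !expr1n; field; rewrite addrC natr1.
rewrite EFinD -!integral_deriv_poly//; congr (_ + _)%E; apply: eq_integral => r.
- rewrite inE/= in_itv/= => /andP[r0 rx]; rewrite q1E ger0_norm ?subr_ge0//.
  by rewrite opprB addrA addrAC.
- rewrite inE/= in_itv/= => /andP[xr r1]; rewrite q2E ler0_norm ?subr_le0//.
  by rewrite opprK addrA.
Qed.

Lemma integral_integral_onem_dist_X K :
  (\int[mu]_(x in `[0%R, 1%R])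
    \int[mu]_(r in `[0%R, 1%R]) ((1 - `|x - r|) ^+ K)%:E =
   (2 / (K%:R + 2))%:E)%E.
Proof.
have K1 : K.+1%:R != 0 :> R by rewrite pnatr_eq0.
have K2 : K.+2%:R != 0 :> R by rewrite pnatr_eq0.
pose q : {poly R} := K.+1%:R^-1 *: (2 *: 'X +
  K.+2%:R^-1 *: ((1 - 'X) ^+ K.+2 - 'X ^+ K.+2)).
rewrite (_ : 2 / _ = q.[1] - q.[0]); last first.
  rewrite /q !hornersE.
  rewrite !subr0 subrr !expr0n/= !expr1n.
  move: K1 K2; rewrite -[K.+2%:R]natr1 -[K.+1%:R]natr1 => K1 K2; field.
  by rewrite K2 K1.
rewrite -integral_deriv_poly//; apply: eq_integral => x.
rewrite inE/= in_itv/= => x01; rewrite integral_onem_dist_X//; congr EFin.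
rewrite /q !derivsE !hornersE.
by field; rewrite (addrC 2) -natrD addn2 (addrC 1) natr1 K1 K2.
Qed.

End calculus.

(** * The uniform law on the unit interval *)

Section uniform.
Context (R : realType).
Notation mu := (@lebesgue_measure R).
Notation U := (uniform_prob (@ltr01 R)).

Lemma integral_uniform01 (f : R -> \bar R) :
  measurable_fun [set: R] f -> (forall x, 0 <= f x)%E ->
  (\int[U]_x f x = \int[mu]_(x in `[0%R, 1%R]) f x)%E.
Proof. by move=> mf f0; rewrite integral_uniform// subr0 invr1 mul1e. Qed.

Lemma uniform01_cc (A : set R) : measurable A -> U A = mu (A `&` `[0, 1]).
Proof.
move=> mA; rewrite -[A in LHS]setIT -integral_indic// integral_uniform01//.
  by rewrite integral_indic.
exact/measurable_EFinP/measurable_indic.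
Qed.

(** The half-open form fits pieces, which are half-open, whereas
    [uniform01_cc] fits the separating intervals [`]x, y]]. *)
Lemma uniform01_co (A : set R) : measurable A -> U A = mu (A `&` `[0, 1[).
Proof.
move=> mA; rewrite -[A in LHS]setIT -integral_indic// integral_uniform01//.
  rewrite -integral_itv_bndo_bndc ?integral_indic//.
  exact/measurable_EFinP/measurable_indic.
exact/measurable_EFinP/measurable_indic.
Qed.

(** For [x <= y] the cuts that separate [x] from [y] are those in
    [`]x, y]]. *)
Lemma uniform01_same_side (x y : R) : 0 <= x <= 1 -> 0 <= y <= 1 ->
  U [set c | (c <= x) = (c <= y)] = (1 - `|x - y|)%:E.
Proof.
wlog xy : x y / x <= y => [hw x01 y01|/andP[x0 _] /andP[_ y1]].
  have [xy|yx] := leP x y; first exact: hw.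
  rewrite (_ : [set c | _] = [set c | (c <= y) = (c <= x)]).
    by rewrite distrC; apply: hw => //; exact: ltW.
  by apply/seteqP; split=> c /= ->.
rewrite (_ : [set c | _] = ~` `]x, y]%classic); last first.
  apply/seteqP; split=> c /=; rewrite in_itv/=.
    by move=> same /andP[]; rewrite -same ltNge => /negP.
  move/negP; have [cx _|xc] := leP c x; first by rewrite (le_trans cx xy).
  by move/negbTE.
transitivity (1 - U `]x, y]%classic)%E; first exact: probability_setC.
rewrite uniform01_cc// setIidl; last first.
  by move=> c /=; rewrite !in_itv/=; lra.
rewrite lebesgue_measure_itv/= lte_fin distrC ger0_norm ?subr_ge0//.
case: ltgtP xy => // ->.
by rewrite sube0 subrr subr0.
Qed.

End uniform.

(** * The piece of a point as the set of points no cut separates from it *)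

Lemma measurable_same_side (R : realType) d (T : measurableType d)
    (c x y : T -> R) :
  measurable_fun [set: T] c -> measurable_fun [set: T] x ->
  measurable_fun [set: T] y ->
  measurable [set t | (c t <= x t) = (c t <= y t)].
Proof.
move=> mc mx my.
have mle (z : T -> R) : measurable_fun [set: T] z ->
    measurable [set t | c t <= z t].
  move=> mz; have := measurable_fun_ler mc mz.
  by move/(_ measurableT [set true]); rewrite setTI; exact.
rewrite (_ : [set t | _] =
  ([set t | c t <= x t] `&` [set t | c t <= y t]) `|`
  (~` [set t | c t <= x t] `&` ~` [set t | c t <= y t])).
  by apply: measurableU; apply: measurableI; try apply: measurableC; exact: mle.
apply/seteqP; split=> t /=.
  by move=> ->; case: (_ <= y t); [left|right].
by move=> [[-> ->]//|[/negP/negbTE -> /negP/negbTE ->]].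
Qed.

Section same_piece.
Context (R : realType) (K : nat).
Implicit Types (c : K.-tuple R) (r x : R).

Definition same_piece c r x : Prop :=
  forall i, (tnth c i <= x) = (tnth c i <= r).

Lemma cut_point_tnth c j : (0 < j <= K)%N ->
  exists i, cut_point c j = tnth c i.
Proof.
case: j => // j /= jK; rewrite /cut_point/= nth_rcons size_sort size_tuple jK.
have /tnthP[i ->] : (sort <=%R c)`_j \in c.
  by rewrite -(mem_sort <=%R) mem_nth// size_sort size_tuple.
by exists i.
Qed.

Lemma tnth_cut_point c i : exists2 j, (0 < j <= K)%N & tnth c i = cut_point c j.
Proof.
have : tnth c i \in sort <=%R c by rewrite mem_sort mem_tnth.
move/(nthP 0) => [j]; rewrite size_sort size_tuple => jK cE.
by exists j.+1 => //; rewrite /cut_point/= nth_rcons size_sort size_tuple jK cE.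
Qed.

(** A cut is either at most [cut_point c j], hence below both points, or at
    least [cut_point c j.+1], hence above both; conversely the two ends of the
    piece are themselves cuts, except for the endpoints 0 and 1, which cannot
    separate points of [`[0, 1[]. *)
Lemma same_pieceP c r x j : (j <= K)%N -> 0 <= x < 1 ->
  cut_point c j <= r < cut_point c j.+1 ->
  same_piece c r x <-> cut_point c j <= x < cut_point c j.+1.
Proof.
move=> jK /andP[x0 x1] /andP[jr rj]; split=> [same|/andP[jx xj] i].
  apply/andP; split.
    case: j jK jr {rj} => [//|j jK jr].
    have [i ciE] := @cut_point_tnth c j.+1 jK.
    by rewrite ciE same -ciE.
  move: jK; rewrite leq_eqVlt => /predU1P[->|jK].
    by rewrite cut_point_last.
  have [i ciE] := @cut_point_tnth c j.+1 jK.
  by rewrite ciE ltNge same -ltNge -ciE.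
have [m /andP[m0 mK] ->] := tnth_cut_point c i.
have [mj|jm] := leqP m j.
  have mj' : cut_point c m <= cut_point c j by rewrite cut_point_le// mj.
  by rewrite (le_trans mj' jx) (le_trans mj' jr).
have jm' : cut_point c j.+1 <= cut_point c m by rewrite cut_point_le// jm.
by rewrite !leNgt (lt_le_trans xj jm') (lt_le_trans rj jm').
Qed.

Lemma cut_point01 c j : (forall i, 0 <= tnth c i <= 1) -> (j <= K.+1)%N ->
  0 <= cut_point c j <= 1.
Proof.
move=> c01; case: j => [|j]; first by rewrite cut_point0 lexx ler01.
rewrite leq_eqVlt => /predU1P[[->]|jK].
  by rewrite cut_point_last lexx ler01.
by have [i ->] := @cut_point_tnth c j.+1 jK.
Qed.

Lemma measurable_same_piece d (T : measurableType d)
    (c : T -> K.-tuple R) (r x : T -> R) :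
  measurable_fun [set: T] c -> measurable_fun [set: T] r ->
  measurable_fun [set: T] x ->
  measurable [set t | same_piece (c t) (r t) (x t)].
Proof.
move=> mc mr mx.
rewrite (_ : [set t | _] = \bigcap_(i in [set: 'I_K])
    [set t | (tnth (c t) i <= x t) = (tnth (c t) i <= r t)]); last first.
  by apply/seteqP; split=> t h i; [move=> _|]; exact: h.
apply: fin_bigcap_measurable => // i _; apply: measurable_same_side => //.
exact: (measurableT_comp (measurable_tnth i) mc).
Qed.

(** The length of the piece turns into the probability of an event that
    mentions the cuts without their order. All cuts in [0, 1] ensures that the
    piece lies in [0, 1], the support of the uniform law. *)
Lemma piece_length_uniform c r : (forall i, 0 <= tnth c i <= 1) ->
  0 <= r < 1 ->
  (piece_length c r)%:E = uniform_prob (@ltr01 R) [set x | same_piece c r x].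
Proof.
move=> c01 r01; have [j jK hj] := piece_exists c r01.
rewrite (piece_lengthE jK hj) uniform01_co; last first.
  exact: measurable_same_piece.
rewrite (_ : _ `&` _ = `[cut_point c j, cut_point c j.+1[%classic); last first.
  have /andP[j0 _] := cut_point01 c01 (leqW jK).
  have /andP[_ j1] := cut_point01 c01 (jK : (j.+1 <= K.+1)%N).
  apply/seteqP; split=> x /=; rewrite !in_itv/=.
    by move=> [same x01]; apply/(same_pieceP jK x01 hj).
  move=> /andP[jx xj].
  have x01 : 0 <= x < 1 by rewrite (le_trans j0 jx) (lt_le_trans xj j1).
  by split=> //; apply/(same_pieceP jK x01 hj); rewrite jx xj.
rewrite lebesgue_measure_itv/= lte_fin -EFinB ifT//.
by move: hj => /andP[]; exact: le_lt_trans.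
Qed.

End same_piece.

(** * Measurability of the length *)

Section measurability.
Context (R : realType) (K : nat).

(** The [j.+1]-th smallest cut is at least [y] exactly when at most [j] cuts
    lie below [y], and the number of cuts below [y] is a sum of measurable
    indicators. *)
Lemma measurable_cut_point j :
  measurable_fun [set: K.-tuple R] (fun c => cut_point c j).
Proof.
have [->|j0] := eqVneq j 0%N; first exact: measurable_cst.
have [jK|Kj] := leqP j K; last first.
  (* beyond the cuts, [cut_point] is 1 or the default value of [nth] *)
  rewrite (_ : (fun c => _) = cst (cut_point (nseq_tuple K 0) j)) //.
  apply/funext => c; case: j j0 Kj => // j _ Kj.
  by rewrite /cut_point/= !nth_rcons !size_sort !size_tuple ltnNge -ltnS Kj/=.
case: j j0 jK => // j _ jK.
apply: (measurability _ (RGenCInfty.measurableE R)) => _ [_ [y ->] <-].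
rewrite setTI.
pose below (c : K.-tuple R) : R := \sum_(i < K) (if tnth c i < y then 1 else 0).
have mbelow : measurable_fun [set: K.-tuple R] below.
  apply: measurable_sum => i; apply: measurable_fun_ifT => //.
  by apply: measurable_fun_ltr => //; exact: measurable_tnth.
have belowE c : below c = (count (< y) (sort <=%R c))%:R.
  rewrite count_sort -sum1_count big_tuple natr_sum [RHS]big_mkcond.
  by apply: eq_bigr => i _; case: ifP.
rewrite (_ : _ @^-1` _ = below @^-1` `]-oo, j%:R]); last first.
  apply/seteqP; split=> c /=; rewrite !in_itv/= belowE ler_nat.
    rewrite andbT; apply: contraLR; rewrite -!ltNge -ltnNge => jc.
    rewrite /cut_point/= nth_rcons size_sort size_tuple jK.
    by apply: nth_count_lt => //; exact: (sort_sorted (@le_total _ R)).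
  move=> cj; rewrite andbT.
  rewrite /cut_point/= nth_rcons size_sort size_tuple jK.
  apply: nth_count_ge; first exact: (sort_sorted (@le_total _ R)).
  by rewrite cj size_sort size_tuple.
by rewrite -[X in measurable X]setTI; exact: mbelow.
Qed.

(** Only the term of the piece that contains [r] can be nonzero; this form is
    visibly measurable, unlike the one by [pick]. *)
Lemma piece_lengthE_sum (c : K.-tuple R) r : piece_length c r =
  \sum_(j < K.+1) if cut_point c j <= r < cut_point c j.+1
                  then cut_point c j.+1 - cut_point c j else 0.
Proof.
rewrite /piece_length; case: pickP => [j hj|none]; last first.
  by rewrite big1// => j _; rewrite none.
rewrite (bigD1 j)//= hj big1 ?addr0// => i ij.
case: ifPn => // hi; case/negP: ij; apply/eqP/val_inj.
by apply: (@piece_unique R K c r i j) => //; rewrite -ltnS.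
Qed.

Lemma piece_length_ge0 (c : K.-tuple R) r : 0 <= piece_length c r.
Proof.
rewrite /piece_length; case: pickP => // j /andP[jr rj].
by rewrite subr_ge0 (le_trans jr)// ltW.
Qed.

Lemma measurable_piece_length d (T : measurableType d)
    (c : T -> K.-tuple R) (r : T -> R) :
  measurable_fun [set: T] c -> measurable_fun [set: T] r ->
  measurable_fun [set: T] (fun t => piece_length (c t) (r t)).
Proof.
move=> mc mr.
have mcut j : measurable_fun [set: T] (fun t => cut_point (c t) j).
  exact: (measurableT_comp (measurable_cut_point j) mc).
under eq_fun do rewrite piece_lengthE_sum.
apply: measurable_sum => j; apply: measurable_fun_ifT => //.
  apply: measurable_and; first exact: measurable_fun_ler.
  exact: measurable_fun_ltr.
exact: measurable_funB.
Qed.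

End measurability.

(** * Tonelli's theorem and independence for sections *)

Section sections.
Context d1 d2 (T1 : measurableType d1) (T2 : measurableType d2) (R : realType)
  (m1 : {sigma_finite_measure set T1 -> \bar R})
  (m2 : {sigma_finite_measure set T2 -> \bar R})
  (S : set (T1 * T2)) (mS : measurable S).

Lemma xsectionE x : xsection S x = [set y | S (x, y)].
Proof. by apply/seteqP; split=> y; rewrite /xsection/= inE. Qed.

Lemma ysectionE y : ysection S y = [set x | S (x, y)].
Proof. by apply/seteqP; split=> x; rewrite /ysection/= inE. Qed.

Lemma measurable_measure_xsection :
  measurable_fun [set: T1] (fun x => m2 [set y | S (x, y)]).
Proof.
by under eq_fun do rewrite -xsectionE; exact: measurable_fun_xsection.
Qed.

Lemma measurable_measure_ysection :
  measurable_fun [set: T2] (fun y => m1 [set x | S (x, y)]).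
Proof.
by under eq_fun do rewrite -ysectionE; exact: measurable_fun_ysection.
Qed.

Lemma integral_measure_sections :
  (\int[m1]_x m2 [set y | S (x, y)] = \int[m2]_y m1 [set x | S (x, y)])%E.
Proof.
under eq_integral do rewrite -xsectionE.
under [RHS]eq_integral do rewrite -ysectionE.
have := indic_fubini_tonelli m1 m2 mS.
by rewrite indic_fubini_tonelli_FE// indic_fubini_tonelli_GE.
Qed.

End sections.

Section probability.
Context d (T : measurableType d) (R : realType) (P : probability T R).

(** Conditioning on [X]: by independence the joint law of [X] and [Y] agrees
    with the product of their laws on rectangles, hence on all measurable
    sets. *)
Lemma independent_RVs_sections d1 d2
    (T1 : measurableType d1) (T2 : measurableType d2)
    (X : {RV P >-> T1}) (Y : {RV P >-> T2}) (S : set (T1 * T2)) :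
  independent_RVs X Y -> measurable S ->
  P [set t | S (X t, Y t)] =
  (\int[distribution P X]_x P [set t | S (x, Y t)])%E.
Proof.
move=> XY mS.
have mXY : measurable_fun [set: T] (fun t => (X t, Y t)).
  by apply: measurable_fun_pair; exact: measurable_funPT.
pose joint : {RV P >-> (T1 * T2)%type} :=
  HB.pack (fun t => (X t, Y t)) (isMeasurableFun.Build _ _ _ _ _ mXY).
transitivity (distribution P joint S) => //.
rewrite -(@product_measure_unique _ _ _ _ _ (distribution P X)
  (distribution P Y) (distribution P joint))//.
  by apply: eq_integral => x _ /=; rewrite xsectionE.
Qed.

(** * The cuts and the root *)

Lemma uniform01_ae (X : {RV P >-> R}) : uniform01 X ->
  \forall t \ae P, 0 <= X t < 1.
Proof.
move=> uX; have mI : measurable (~` `[0, 1[%classic : set R).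
  exact: measurableC.
exists (X @^-1` ~` `[0, 1[); split.
- by rewrite -[_ @^-1` _]setTI; exact: (measurable_funPT X).
- by rewrite [P _](uX _ mI) uniform01_co// setICl measure0.
- by move=> t /= t01; rewrite in_itv.
Qed.

Lemma prob_same_piece K (c : 'I_K -> {RV P >-> R}) (r x : R) :
  iid_uniform01 c -> 0 <= r <= 1 -> 0 <= x <= 1 ->
  P [set t | same_piece (random_vector c t) r x] =
  ((1 - `|x - r|) ^+ K)%:E.
Proof.
move=> [indep unif] r01 x01.
pose A : set R := [set y | (y <= x) = (y <= r)].
have mA : measurable A by exact: measurable_same_side.
transitivity (P (\bigcap_(i in [set` [set: 'I_K]%SET]) (c i @^-1` A))).
  congr (P _); apply/seteqP; split=> t /=.
    by move=> h i _; have := h i; rewrite tnth_mktuple.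
  by move=> h i; rewrite tnth_mktuple; apply: h; rewrite /= inE.
rewrite (indep [set: 'I_K]%SET (fun=> A))//.
under eq_bigr do rewrite [P _](unif _ A mA) uniform01_same_side//.
by rewrite prodEFin prodr_const cardsT card_ord.
Qed.

End probability.

Unset Implicit Arguments.
Set Strict Implicit.

Theorem proposition16 (R : realType) (d : measure_display)
    (T : measurableType d) (P : probability T R) (K : nat) (hK : (1 <= K)%N)
    (r0 : {RV P >-> R}) (c0 : 'I_K -> {RV P >-> R})
    (hr0 : uniform01 r0) (hc0 : iid_uniform01 c0)
    (hind : independent_RVs r0 (random_vector c0)) :
  ('E_P[fun t : T => piece_length (random_vector c0 t) (r0 t)] =
   (2 / (K%:R + 2))%:E)%E.
Proof.
(* [TR] is [R] with the Borel structure generated by half-open intervals, on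
   which Lebesgue measure and [uniform_prob] live; its measurable sets are those
   of [R], but as a measurable type it is distinct, so [r] retypes [r0]. *)
pose TR := measurableTypeR R.
pose U : probability TR R := uniform_prob (@ltr01 R).
pose c := random_vector c0.
have mc : measurable_fun [set: T] c by exact: measurable_random_vector.
have mr : measurable_fun [set: T] r0 by exact: measurable_funPT.
have mr' : measurable_fun [set: T] (r0 : T -> TR) by exact: mr.
pose r : {RV P >-> TR} :=
  HB.pack (r0 : T -> TR) (isMeasurableFun.Build _ _ T TR _ mr').
pose S : set (T * TR) := [set p | same_piece (c p.1) (r0 p.1) p.2].
have mS : measurable S.
  apply: measurable_same_piece; first exact: measurableT_comp.
    exact: measurableT_comp.
  exact: (@measurable_snd _ _ T TR).
rewrite unlock.
(* the length is a probability only almost surely: the cuts and the root may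
   leave [`[0, 1[] on a null event *)
transitivity (\int[P]_t U [set x | S (t, x)])%E.
  apply: ge0_ae_eq_integral => //.
  - exact/measurable_EFinP/measurable_piece_length.
  - exact: (measurable_measure_xsection U mS).
  - by move=> t _; rewrite lee_fin piece_length_ge0.
  - have hr := uniform01_ae hr0.
    have hc : \forall t \ae P, forall i, 0 <= c0 i t < 1.
      by apply: filter_forall => i; apply: uniform01_ae; case: hc0.
    apply: filterS2 hr hc => t r01 c01 _.
    apply: piece_length_uniform => // i.
    by rewrite tnth_mktuple; case/andP: (c01 i) => -> /ltW.
rewrite (integral_measure_sections P U mS) -(integral_integral_onem_dist_X R K).
rewrite integral_uniform01//; last first.
  exact: (measurable_measure_ysection P mS).
apply: eq_integral => x; rewrite inE/= in_itv/= => x01.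
pose Sx : set (TR * K.-tuple R) := [set p | same_piece p.2 p.1 x].
have mSx : measurable Sx by exact: measurable_same_piece.
transitivity (P [set t | Sx (r t, c t)]) => //.
have rc : independent_RVs r (random_vector c0) by exact: hind.
rewrite (independent_RVs_sections rc mSx).
rewrite [LHS](@eq_measure_integral _ _ _ _ U); last first.
  by move=> A mA _; exact: hr0.
rewrite integral_uniform01//; last first.
  exact: (measurable_measure_xsection (distribution P c) mSx).
apply: eq_integral => y; rewrite inE/= in_itv/= => y01.
exact: prob_same_piece.
Qed.
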